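(* Let $\mathbb{X}$ be a Banach space and let $T\in\mathcal{A}(\mathbb{X})$. Let $V$ on $\mathbb{X}'$ be an isometric dilation of $\frac{T}{\|T\|}$ with $W:\mathbb{X}\to\mathbb{X}'$ being the isometric embedding. Then $x\in M_T$ if and only if $x\in\ker\big((I-P_{W(\mathbb{X})})VW\big)\cap S_{\mathbb{X}}$.
   Context: Banach spaces are over the complex field and operators are nonzero. $S_{\mathbb{X}}$ is the set of unit vectors of $\mathbb{X}$ and $M_T=\{x\in S_{\mathbb{X}}:\|Tx\|=\|T\|\}$. $\mathcal{A}(\mathbb{X})$ is the class of $T\in\mathcal{B}(\mathbb{X})$ (bounded linear operators on $\mathbb{X}$) such that $T/\|T\|$ dilates to an isometry on some normed (or semi-normed) space. A contraction $S$ on $\mathbb{X}$ has isometric dilation $V$ on a normed or semi-normed space $\mathbb{X}'$, where $V:\mathbb{X}'\to\mathbb{X}'$ is linear and (semi-)norm preserving, if there are a linear (semi-)norm-preserving map $W:\mathbb{X}\to\mathbb{X}'$ (the isometric embedding) and a closed linear subspace $\mathbb{L}\subseteq\mathbb{X}'$ such that $\mathbb{X}'$ is isomorphic with $W(\mathbb{X})\oplus_2\mathbb{L}$ (every $u\in\mathbb{X}'$ is uniquely $u=w+l$ with $w\in W(\mathbb{X})$, $l\in\mathbb{L}$, and $\|u\|^2=\|w\|^2+\|l\|^2$) and, with $\widehat{W}:=W:\mathbb{X}\to W(\mathbb{X})$ and $\widehat{S}:=\widehat{W}S\widehat{W}^{-1}$, one has $q(\widehat{S})=P_{W(\mathbb{X})}\,q(V)|_{W(\mathbb{X})}$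 for all polynomials $q\in\mathbb{C}[z]$, where $P_{W(\mathbb{X})}$ is the norm-one projection of $\mathbb{X}'$ onto $W(\mathbb{X})$, $P_{W(\mathbb{X})}(w+l)=w$.
   Formalization: For properly semi-normed X' the literal kernel makes the claim false, so there ker((I-P)VW) is read modulo null vectors, i.e. as the x with ||(I-P)VWx|| = 0; for normed X' the equivalence is with the literal kernel. *)

(* Defs.v *)
From HB Require Import structures.
From mathcomp Require Import all_boot all_order all_algebra.
From mathcomp Require Import all_classical all_reals all_analysis.
From mathcomp Require Import complex.

Set Implicit Arguments.
Unset Strict Implicit.
Unset Printing Implicit Defensive.

Import Order.TTheory GRing.Theory Num.Theory.
Import numFieldNormedType.Exports.

Local Open Scope classical_set_scope.
Local Open Scope complex_scope.
Local Open Scope ring_scope.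

(* The norm is called [snorm] because the [`|_|] of the library cannot be reused:
   the join of its semi-normed groups with left modules would have to be declared
   below [normedModType].  As there, norms have values in the scalars; [0 <= snorm v]
   follows from the axioms. *)
HB.mixin Record Lmodule_isSemiNormed (K : numDomainType) V
    of GRing.Lmodule K V := {
  snorm : V -> K;
  ler_snormD : forall u v : V, snorm (u + v) <= snorm u + snorm v;
  snormZ : forall (a : K) (v : V), snorm (a *: v) = `|a| * snorm v;
}.

#[short(type="semiNormedModType")]
HB.structure Definition SemiNormedModule (K : numDomainType) :=
  {V of GRing.Lmodule K V & Lmodule_isSemiNormed K V}.

Definition is_normed (K : numDomainType) (E : semiNormedModType K) : Prop :=
  forall u : E, snorm u = 0 -> u = 0.

(* Closedness for the topology of the semi-norm. *)
Definition snorm_closed (K : numDomainType) (E : semiNormedModType K)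
    (A : set E) : Prop :=
  forall u, (forall e : K, 0 < e -> exists2 a, A a & snorm (u - a) < e) -> A u.

Section Operators.
Variables (R : realType) (X : normedModType R[i]).

Definition unit_sphere : set X := [set x | `|x| = 1].

Definition bounded_operator (T : {linear X -> X}) : Prop :=
  bounded_near T (nbhs (0 : X)).

(* Norms of vectors of a complex space have type [R[i]], hence the real part. *)
Definition opnorm (T : {linear X -> X}) : R :=
  sup [set complex.Re `|T x| | x in [set x : X | `|x| <= 1]].

Definition norm_attainment_set (T : {linear X -> X}) : set X :=
  [set x | unit_sphere x /\ `|T x| = (opnorm T)%:C].

Definition normalized (T : {linear X -> X}) : {linear X -> X} :=
  ((opnorm T)^-1)%:C \*: T.

End Operators.

Arguments unit_sphere {R} X _.

Definition poly_op (K : nzRingType) (E : lmodType K) (q : {poly K}) (f : E -> E)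
    (u : E) : E :=
  \sum_(i < size q) q`_i *: iter i f u.

Section Dilation.
Variables (R : realType) (X : normedModType R[i]) (X' : semiNormedModType R[i]).

(* The projection of [X'] onto [W(X)] along [L]; junk value [0] on the vectors
   with no component in [W(X)]. *)
Definition range_proj (W : {linear X -> X'}) (L : set X') (u : X') : X' :=
  xget 0 [set w | range W w /\ L (u - w)].

(* [W S W^-1], only meaningful on [W(X)]. *)
Definition transport (W : {linear X -> X'}) (S : X -> X) (u : X') : X' :=
  W (S ('pinv_(fun=> 0) setT W u)).

Record isometric_dilation (S : {linear X -> X}) (V : {linear X' -> X'})
    (W : {linear X -> X'}) (L : set X') : Prop := {
  dilation_isometry : forall u, snorm (V u) = snorm u ;
  embedding_isometry : forall x, snorm (W x) = `|x| ;
  complement_submod : L 0 /\ forall (a : R[i]) u v, L u -> L v -> L (a *: u + v) ;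
  complement_closed : snorm_closed L ;
  complement_direct : forall u, exists! wl : X' * X',
    [/\ range W wl.1, L wl.2 & u = wl.1 + wl.2] ;
  complement_norm : forall w l, range W w -> L l ->
    snorm (w + l) ^+ 2 = snorm w ^+ 2 + snorm l ^+ 2 ;
  dilation_poly : forall (q : {poly R[i]}) u, range W u ->
    poly_op q (transport W S) u = range_proj W L (poly_op q V u) }.

(* The operator [(I - P) V W]. *)
Definition defect (V : {linear X' -> X'}) (W : {linear X -> X'}) (L : set X')
    (x : X) : X' :=
  V (W x) - range_proj W L (V (W x)).

Definition ker (A : X -> X') : set X := [set x | A x = 0].

(* In a semi-normed space vectors are only determined up to null vectors, so
   the kernel is the preimage of the null vectors; this is [ker A] when [X'] is
   normed. *)
Definition snorm_ker (A : X -> X') : set X := [set x | snorm (A x) = 0].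

End Dilation.

Definition class_A (R : realType) (X : normedModType R[i])
    (T : {linear X -> X}) : Prop :=
  [/\ bounded_operator T, exists x, T x != 0 &
    exists (X' : semiNormedModType R[i]) (V : {linear X' -> X'})
           (W : {linear X -> X'}) (L : set X'),
      isometric_dilation (normalized T) V W L].

(* Main.v *)
Require Import Defs.
From mathcomp Require Import all_boot all_order all_algebra.
From mathcomp Require Import all_classical all_reals all_analysis.
From mathcomp Require Import complex.

(** On the range of [W] the dilation identity for [q = 'X] reads [W S x = P V W x],
    where [S = T / ||T||]. Hence [V W x = W S x + (I - P) V W x] is an orthogonal
    decomposition, and since [V] and [W] preserve norms,
    [||x||^2 = ||S x||^2 + ||(I - P) V W x||^2]. On the unit sphere, [||S x|| = 1]
    therefore amounts to the vanishing of the last term. *)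

Set Implicit Arguments.
Unset Strict Implicit.
Unset Printing Implicit Defensive.

Import Order.TTheory GRing.Theory Num.Theory.
Import numFieldNormedType.Exports.

Local Open Scope classical_set_scope.
Local Open Scope ring_scope.

Lemma poly_opX (K : nzRingType) (E : lmodType K) (f : E -> E) (u : E) :
  poly_op 'X f u = f u.
Proof.
rewrite /poly_op size_polyX !big_ord_recl big_ord0 /= !coefX /=.
by rewrite scale0r scale1r add0r addr0.
Qed.

(** Rescaling [x] to norm one gives a positive element of the set whose supremum is [opnorm T];
    boundedness of [T] makes that supremum an upper bound. *)
Lemma bounded_operator_opnorm_gt0 (R : realType) (X : normedModType R[i])
    (T : {linear X -> X}) (x : X) :
  bounded_operator T -> T x != 0 -> 0 < opnorm T.
Proof.
move=> /linear_boundedP /pinfty_ex_gt0 [M M0 TM] Tx0.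
have x0 : x != 0 by apply: contraNneq Tx0 => ->; rewrite linear0.
pose y := `|x|^-1 *: x.
have y1 : `|y| = 1 by rewrite normrZ normfV normr_id mulVf ?normr_eq0.
have Ty : 0 < `|T y|.
  by rewrite normr_gt0 linearZ scaler_eq0 negb_or invr_eq0 normr_eq0 x0.
(* A strict inequality in [R[i]] includes the one between real parts, where [opnorm] lives. *)
move: (Ty); rewrite ltcE => /andP[_ /lt_le_trans]; apply.
apply: ub_le_sup; last by exists y => //=; rewrite y1.
exists (complex.Re M) => _ [z /= z1 <-].
have : `|T z| <= M by apply: le_trans (TM z) _; rewrite ler_piMr // ltW.
by rewrite lecE => /andP[].
Qed.

Section Dilation.
Variables (R : realType) (X : normedModType R[i]) (X' : semiNormedModType R[i]).
Variables (S : {linear X -> X}) (V : {linear X' -> X'}).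
Variables (W : {linear X -> X'}) (L : set X').
Hypothesis SVW : isometric_dilation S V W L.

(** Null vectors may exist in [X'] but not in [X], so the norm-preserving [W] has trivial kernel. *)
Lemma embedding_inj : injective W.
Proof.
move=> x y Wxy; apply/eqP; rewrite -subr_eq0 -normr_eq0.
rewrite -(embedding_isometry SVW) linearB Wxy subrr.
by rewrite -(scale0r 0) snormZ normr0 mul0r.
Qed.

Lemma transport_embedding (f : X -> X) (x : X) : transport W f (W x) = W (f x).
Proof.
by rewrite /transport pinvKV ?in_setT // => y z _ _; exact: embedding_inj.
Qed.

Lemma range_proj_dilation (x : X) : range_proj W L (V (W x)) = W (S x).
Proof.
have := dilation_poly SVW 'X (imageT W x).
by rewrite !poly_opX transport_embedding => ->.
Qed.

Lemma range_proj_compl (u : X') : L (u - range_proj W L u).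
Proof.
have [[w l] [[/= Ww Ll uwl] _]] := complement_direct SVW u.
suff: [set w | range W w /\ L (u - w)] (range_proj W L u) by case.
(* The decomposition of [u] supplies a candidate, so [range_proj] does not fall back on the default
   [0]. *)
by apply: xgetPex; exists w; split=> //; rewrite uwl /= addrC addKr.
Qed.

Lemma dilation_pythagoras (x : X) :
  `|x| ^+ 2 = `|S x| ^+ 2 + snorm (defect V W L x) ^+ 2.
Proof.
rewrite -!(embedding_isometry SVW) -(dilation_isometry SVW).
rewrite -(complement_norm SVW (imageT W _) (range_proj_compl _)).
by rewrite -range_proj_dilation addrC subrK.
Qed.

Lemma defect_null_iff (x : X) :
  `|S x| = `|x| <-> snorm (defect V W L x) = 0.
Proof.
have pyth := dilation_pythagoras x; split=> [Sx|d0].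
  move/eqP: pyth; rewrite Sx -subr_eq0 opprD addNKr.
  by rewrite oppr_eq0 sqrf_eq0 => /eqP.
(* Squaring is injective on nonnegative scalars, so it suffices to compare squared norms. *)
by apply/eqP; rewrite -(@eqrXn2 _ 2) // pyth d0 expr0n addr0.
Qed.

End Dilation.

(** Division by a positive scalar is reversible; this links norm attainment of [T] to
    [defect_null_iff] on the unit sphere. *)
Lemma norm_normalized_eq1 (R : realType) (X : normedModType R[i])
    (T : {linear X -> X}) (x : X) :
  0 < opnorm T -> `|normalized T x| = 1 <-> `|T x| = (opnorm T)%:C%C.
Proof.
move=> T0; have TC0 : 0 < (opnorm T)%:C%C by rewrite ltcR.
rewrite /normalized /= normrZ fmorphV ger0_norm ?invr_ge0 ?(ltW TC0) //.
split=> [|->]; last by rewrite mulVf ?gt_eqF.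
by move=> /(congr1 ( *%R (opnorm T)%:C%C)); rewrite mulVKf ?gt_eqF // mulr1.
Qed.

Unset Implicit Arguments.

Theorem theorem8p3 (R : realType) (X : completeNormedModType R[i])
    (T : {linear X -> X}) (hT : class_A T)
    (X' : semiNormedModType R[i]) (V : {linear X' -> X'})
    (W : {linear X -> X'}) (L : set X')
    (hV : isometric_dilation (normalized T) V W L) (x : X) :
  (norm_attainment_set T x <->
     (snorm_ker (defect V W L) `&` unit_sphere X) x) /\
  (is_normed X' ->
     (norm_attainment_set T x <->
        (ker (defect V W L) `&` unit_sphere X) x)).
Proof.
have [Tb [x0 Tx0] _] := hT.
have T0 := bounded_operator_opnorm_gt0 Tb Tx0.
have main : norm_attainment_set T x <->
    (snorm_ker (defect V W L) `&` unit_sphere X) x.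
  split=> [[x1 Tx]|[d0 x1]]; split=> //.
    by apply/(defect_null_iff hV); rewrite x1; apply/norm_normalized_eq1.
  by apply/norm_normalized_eq1 => //; rewrite -[RHS]x1; apply/(defect_null_iff hV).
(* When [X'] is normed its only null vector is [0], so both kernels agree; [snorm 0 = 0] comes from
   homogeneity at the scalar [0]. *)
split=> // X'n; apply: (iff_trans main); split=> -[d0 x1]; split=> //.
  exact: X'n.
by rewrite /snorm_ker /= d0 -(scale0r 0) snormZ normr0 mul0r.
Qed.
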